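(* Let $X$ and $Y$ be locally compact Hausdorff spaces and let $F:X\to Y$ be a continuous map. Then the following are equivalent: (a) $F$ is injective and proper; (b) $\overline{F^*(A)}=C_0(X)$ for some norm dense subset $A$ of $C_0(Y)$; (c) $\overline{F^*(A)}=C_0(X)$ for every norm dense subset $A$ of $C_0(Y)$.
   Context: $C_0(X)$ denotes the $C^*$-algebra of complex-valued continuous functions on $X$ vanishing at infinity (for every $\varepsilon>0$ there is a compact $K\subseteq X$ with $|f(x)|<\varepsilon$ for all $x\notin K$). $F^*(f):=f\circ F$, regarded as a map from $C_0(Y)$ to the algebra $C_b(X)$ of bounded continuous complex-valued functions on $X$; the bar denotes closure in the supremum norm. A continuous map $F:X\to Y$ is called proper if $F\times\mathrm{id}:X\times Z\to Y\times Z$ is closed for every topological space $Z$; for $X$ Hausdorff and $Y$ locally compact Hausdorff this is equivalent to $F^{-1}(K)$ being compact for every compact $K\subseteq Y$. *)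

(* Defs.v *)
From HB Require Import structures.
From mathcomp Require Import all_boot all_order all_algebra.
From mathcomp Require Import all_classical all_reals all_analysis.
From mathcomp Require Import complex.

Set Implicit Arguments.
Unset Strict Implicit.
Unset Printing Implicit Defensive.

Import Order.TTheory GRing.Theory Num.Theory Normc.
Import numFieldTopology.Exports numFieldNormedType.Exports.

Local Open Scope classical_set_scope.
Local Open Scope ring_scope.
Local Open Scope complex_scope.

(* The library puts a topology on [R[i]^o], as it does for every
   numClosedFieldType, but none on the bare carrier [R[i]]; transfer it. *)
HB.instance Definition _ (R : realType) := PseudoPointedMetric.copy R[i] R[i]^o.
HB.instance Definition _ (R : realType) := GRing.ComAlgebra.copy R[i] R[i]^o.
HB.instance Definition _ (R : realType) := NormedModule.copy R[i] R[i]^o.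

Definition proper_map (X Y : topologicalType) (F : X -> Y) : Prop :=
  continuous F /\
  forall (Z : topologicalType) (E : set (X * Z)),
    closed E -> closed ((fun p : X * Z => (F p.1, p.2)) @` E).

Section Cb.
Variables (R : realType) (X : topologicalType).

Definition cont_bounded : {pred X -> R[i]} :=
  mem [set f : X -> R[i] | continuous f /\ bounded_fun f].

Lemma bounded_funC (f : X -> R[i]) :
  bounded_fun f <-> exists M : R, forall x, normc (f x) <= M.
Proof.
split=> [[M [Mr Mf]]|[M Mf]].
  have /Mf h : M < (complex.Re M + 1)%:C.
    by rewrite -(RRe_real Mr) ltcR ltrDl ltr01.
  by exists (complex.Re M + 1) => x; rewrite -lecR; exact: h.
exists M%:C; split; first by apply/complex_realP; exists M.
move=> y /ltW My x _; apply: le_trans My.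
by rewrite -[`|_|]/((normc (f x))%:C) lecR.
Qed.

Lemma cont_boundedP (f : X -> R[i]) : f \in cont_bounded <->
  continuous f /\ exists M : R, forall x, normc (f x) <= M.
Proof. by rewrite inE /=; split=> -[cf /bounded_funC bf]. Qed.

Record Cb : Type := MkCb {
  Cb_fun :> X -> R[i];
  Cb_funP : Cb_fun \in cont_bounded
}.
HB.instance Definition _ := [isSub for Cb_fun].
HB.instance Definition _ := [Choice of Cb by <:].

Lemma cont_bounded_submod : submod_closed cont_bounded.
Proof.
split=> [|l f g /cont_boundedP[cf [M Mf]] /cont_boundedP[cg [N Ng]]].
  apply/cont_boundedP; split; first exact: cst_continuous.
  by exists 0 => x; rewrite normc0.
apply/cont_boundedP; split.
  move=> x; apply: (@cvgD _ R[i]^o); last exact: cg.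
  by apply: (@cvgZl_tmp _ R[i]^o); exact: cf.
exists (normc l * M + N) => x.
apply: le_trans (le_normcD _ _) _; rewrite lerD//.
by rewrite [normc _](normcM l (f x)) ler_wpM2l// -lecR; exact: (normr_ge0 l).
Qed.
HB.instance Definition _ :=
  GRing.isSubmodClosed.Build _ _ cont_bounded cont_bounded_submod.
HB.instance Definition _ := [SubChoice_isSubLmodule of Cb by <:].

Definition supnorm (f : X -> R[i]) : R := sup (range (fun x => normc (f x))).

Lemma normc_ge0 (z : R[i]) : 0 <= normc z.
Proof. by rewrite -lecR; exact: (normr_ge0 z). Qed.

Lemma supnorm_ub (f : Cb) x : normc (f x) <= supnorm f.
Proof.
have /cont_boundedP[_ [M Mf]] := Cb_funP f.
by apply: ub_le_sup; [exists M => _ [y _ <-]; exact: Mf|exists x].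
Qed.

Lemma supnorm_le (f : X -> R[i]) M : 0 <= M ->
  (forall x, normc (f x) <= M) -> supnorm f <= M.
Proof.
move=> M0 Mf; rewrite /supnorm.
have [->|/set0P ne] := eqVneq (range (fun x => normc (f x))) set0.
  by rewrite sup0.
by apply: ge_sup => // _ [y _ <-]; exact: Mf.
Qed.

Lemma supnorm_ge0 (f : Cb) : 0 <= supnorm f.
Proof.
rewrite /supnorm.
have [->|/set0P[_ [x _ _]]] := eqVneq (range (fun x => normc (f x))) set0.
  by rewrite sup0.
exact: le_trans (normc_ge0 (f x)) (supnorm_ub f x).
Qed.

Definition Cb_norm (f : Cb) : R[i] := (supnorm f)%:C.

Lemma ler_Cb_normD (f g : Cb) : Cb_norm (f + g) <= Cb_norm f + Cb_norm g.
Proof.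
rewrite /Cb_norm -rmorphD lecR; apply: supnorm_le => [|x].
  by rewrite addr_ge0 ?supnorm_ge0.
by apply: le_trans (le_normcD _ _) _; rewrite lerD ?supnorm_ub.
Qed.

Lemma Cb_normZ (l : R[i]) (f : Cb) : Cb_norm (l *: f) = `|l| * Cb_norm f.
Proof.
rewrite -[`|l|]/((normc l)%:C) /Cb_norm -rmorphM; congr (_%:C).
have le_supZ (k : R[i]) (h : Cb) : supnorm (k *: h) <= normc k * supnorm h.
  apply: supnorm_le => [|x]; first by rewrite mulr_ge0 ?normc_ge0 ?supnorm_ge0.
  by rewrite [normc _](normcM k (h x)) ler_wpM2l ?normc_ge0 ?supnorm_ub.
apply/eqP; rewrite eq_le le_supZ andTb.
have [->|l0] := eqVneq l 0; first by rewrite normc0 mul0r; exact: supnorm_ge0.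
have nl0 : 0 < normc l.
  by rewrite lt_def normc_ge0 andbT; apply: contra l0 => /eqP/eq0_normc->.
rewrite mulrC -ler_pdivlMr// mulrC -normcV.
by rewrite -{1}[f](scalerK l0) le_supZ.
Qed.

Lemma Cb_norm0_eq0 (f : Cb) : Cb_norm f = 0 -> f = 0.
Proof.
move=> /complexI f0; apply/val_inj/funext => x; apply/eq0_normc/eqP.
by rewrite eq_le normc_ge0 andbT -f0; exact: supnorm_ub.
Qed.

HB.instance Definition _ :=
  Lmodule_isNormed.Build R[i] Cb ler_Cb_normD Cb_normZ Cb_norm0_eq0.

Lemma Cb_closureP (A : set Cb) (f : Cb) :
  closure A f <-> forall e : R, 0 < e -> exists2 g, A g & supnorm (f - g) < e.
Proof.
split=> [Af e e0|Af U /nbhs_ballP[_/posnumP[e] fU]].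
  have eC0 : 0 < e%:C by rewrite ltcR.
  have [g [Ag fg]] := Af _ (nbhsx_ballx f _ eC0).
  by exists g => //; rewrite -ltcR; move: fg; rewrite -ball_normE.
have er : e%:num = (complex.Re e%:num)%:C.
  by rewrite RRe_real ?gtr0_real.
have [|g Ag fg] := Af (complex.Re e%:num); first by rewrite -ltcR -er; exact: gt0.
exists g; split=> //; apply: fU; rewrite -ball_normE /= er.
by rewrite -[`|_|]/((supnorm (f - g))%:C) ltcR.
Qed.

(* Membership in [Cb] is no restriction: a continuous function vanishing at
   infinity is bounded. *)
Definition C0 : set Cb :=
  [set f | forall e : R, 0 < e ->
     exists2 K : set X, compact K & forall x, ~ K x -> normc (f x) < e].

Lemma vanishing_cont_bounded (f : X -> R[i]) : continuous f ->
  (forall e : R, 0 < e ->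
     exists2 K : set X, compact K & forall x, ~ K x -> normc (f x) < e) ->
  f \in cont_bounded.
Proof.
move=> cf /(_ 1 ltr01)[K cK Kf].
have cnf : continuous (fun x => normc (f x)).
  move=> x; apply/cvgrPdist_lt => e e0.
  have eC0 : 0 < e%:C by rewrite ltcR.
  have /cvgrPdist_lt/(_ _ eC0) := cf x.
  apply: (@filterS _ (nbhs x)) => y; rewrite -[`|_ - f y|]/((normc (f x - f y))%:C) ltcR.
  by apply: le_lt_trans; exact: (@ler_dist_dist _ (Rcomplex R)).
have cfK : compact ((fun x => normc (f x)) @` K).
  by apply: continuous_compact => //; exact: continuous_subspaceT.
have [M [_ /(_ (M + 1)) Mf]] := compact_bounded cfK.
have {}/Mf {}Mf : M < M + 1 by rewrite ltrDl.
apply/cont_boundedP; split => //; exists (Num.max (M + 1) 1) => x.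
rewrite le_max; have [Kx|/Kf/ltW ->] := pselect (K x); last by rewrite orbT.
apply/orP; left; apply: le_trans (ler_norm _) _; apply: Mf; by exists x.
Qed.

End Cb.

Arguments C0 : clear implicits.

Section pullback.
Variables (R : realType) (X Y : topologicalType) (F : X -> Y).
Hypothesis cF : continuous F.

Lemma pullback_subproof (f : Cb R Y) : f \o F \in @cont_bounded R X.
Proof.
have /cont_boundedP[cf [M Mf]] := Cb_funP f.
apply/cont_boundedP; split; last by exists M => x; exact: Mf.
by move=> x; apply: continuous_comp; [exact: cF|exact: cf].
Qed.

Definition pullback (f : Cb R Y) : Cb R X := MkCb (pullback_subproof f).

End pullback.

Definition norm_dense_in (R : realType) (Y : topologicalType)
    (B A : set (Cb R Y)) : Prop :=
  A `<=` B /\ B `<=` closure A.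

(* Main.v *)
Require Import Defs.
From HB Require Import structures.
From mathcomp Require Import all_boot all_order all_algebra.
From mathcomp Require Import all_classical all_reals all_analysis.
From mathcomp Require Import complex.
Set Implicit Arguments.
Unset Strict Implicit.
Unset Printing Implicit Defensive.
Import Order.TTheory GRing.Theory Num.Theory Normc.
Import numFieldTopology.Exports numFieldNormedType.Exports.
Local Open Scope classical_set_scope.
Local Open Scope ring_scope.
Local Open Scope complex_scope.

(** The map [F] is compared with its pullback on functions vanishing at
    infinity, both spaces being seen inside their one-point compactifications.

    For locally compact Hausdorff spaces, [F] is proper exactly when preimages
    of compact sets are compact.  One direction is obtained by testing the
    definition of properness on a single space, the one-point compactification
    of the source ([proper_map_compact_preimage]); the other is a
    tube-lemma argument ([compact_preimage_proper_map]).

    If [F] is injective and proper, it is a homeomorphism onto a closed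
    subspace, and a function [g] vanishing at infinity on [X] becomes, once
    transported to the image of [F] and extended by [0] at infinity, a
    continuous function on a closed subset of the one-point compactification
    of [Y].  That space is compact Hausdorff, hence normal, so Tietze's theorem
    extends [g] further ([pullback_C0_surjective]).  The pullback therefore
    maps [C0 Y] onto [C0 X].

    The pullback is a contraction, so the closure of the image of a dense
    subset [A] of [C0 Y] does not depend on [A] ([closure_pullback_dense]);
    this makes the existential and the universal condition equivalent, and
    reduces both to the case [A = C0 Y].

    Conversely, suppose that the pullback maps [C0 Y] onto a dense subset of
    [C0 X].  Functions of the form [f \o F] cannot distinguish two points with
    the same image, whereas [C0 X] separates points by Urysohn's lemma; so [F]
    is injective ([pullback_dense_injective]).  If [f] in [C0 Y] equals [1] on
    a compact [K], then [f \o F] lies in [C0 X] and equals [1] on the preimage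
    of [K], which is thus compact ([pullback_C0_compact_preimage]). *)

(** * Proper maps and preimages of compact sets *)

(** Any nonempty test space [Z] would do to see that a proper map is closed;
    [bool] is a convenient one. *)
Lemma proper_map_closed_image (X Y : topologicalType) (F : X -> Y)
    (C : set X) :
  proper_map F -> closed C -> closed (F @` C).
Proof.
move=> [_ pF] cC.
have /pF clFC : closed ([set p | C p.1] : set (X * bool)).
  by apply: (@preimage_closed (X * bool)%type _ fst) => // p _; exact: cvg_fst.
move=> y clFy.
have [|[x b] /= Cx [<- _]] := clFC (y, true); last by exists x.
move=> U [[V W] /= [Vy Wt] VWU].
have [_ [[x Cx <-] Vx]] := clFy _ Vy.
exists (F x, true); split; first by exists (x, true).
by apply: VWU; split => //; exact: nbhs_singleton Wt.
Qed.

(** Let [H] be the image under [F * id] of the graph of the inclusion of [X] in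
    its one-point compactification.  This graph is closed, because the
    compactification is Hausdorff, and it has no point above infinity; so [H]
    is closed and avoids every [(y, infinity)].  As [K] is compact, one
    neighbourhood of infinity works for all [y] in [K] at once.  It contains the
    complement of a compact subset of [X], and this compact set contains the
    preimage of [K]. *)
Lemma proper_map_compact_preimage (X Y : topologicalType) (F : X -> Y)
    (K : set Y) :
  hausdorff_space X -> locally_compact [set: X] -> hausdorff_space Y ->
  proper_map F -> compact K -> compact (F @^-1` K).
Proof.
move=> hX lX hY [cF pF] cK.
pose opX := one_point_compactification X.
pose graph := [set p : X * opX | p.2 = Some p.1].
have /pF clH : closed graph.
  move=> [x z] clxz; apply: one_point_compactification_hausdorff => //.
  move=> A B Az Bx.
  have [|[x' z'] [z'E [/= Bx' Ax']]] := clxz (Some @^-1` B `*` A).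
    by exists (Some @^-1` B, A).
  by exists z'; split=> //; rewrite [z']z'E.
have cFK : closed (F @^-1` K).
  by apply: preimage_closed => [x _|]; [exact: cF|exact: compact_closed].
move/compact_near_coveringP : cK => /(_ _ (nbhs (None : opX))
  (fun w y => ~ [set (F p.1, p.2) | p in graph] (y, w)) _)[].
  move=> y Ky.
  have [|U Uy UH] := @open_nbhs_nbhs (Y * opX)%type (y, None) _
      (conj (closed_openC clH) _).
    by case=> -[x z] + [_ /= z0]; rewrite /graph /= z0.
  by exists U => // -[y' w]; exact: UH.
move=> C [cC _] CH; apply: (subclosed_compact cFK cC) => x FKx.
apply: contrapT => nCx.
have := CH (Some x) _ (F x) FKx; apply; last by exists (x, Some x).
by left; exists x.
Qed.

(** Suppose that [(y, z)] is not in the image of the closed set [E], and let [K]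
    be a compact neighbourhood of [y].  Near each [x] in the preimage of [K],
    no point of [E] has an image close to [(y, z)]: if [F x = y] because [E] is
    closed, otherwise because [Y] is Hausdorff.  That preimage
    being compact, a neighbourhood of [(y, z)] can be chosen uniformly in [x];
    intersected with the points over [K], it misses the image of [E]. *)
Lemma compact_preimage_proper_map (X Y : topologicalType) (F : X -> Y) :
  hausdorff_space Y -> locally_compact [set: Y] -> continuous F ->
  (forall K, compact K -> compact (F @^-1` K)) -> proper_map F.
Proof.
move=> hY lY cF cpF; split=> // Z E clE [y z] clyz.
have [K] := lY y I; rewrite withinET => Ky [cK _].
apply: contrapT => nFE.
(* The filter of neighbourhoods of [(y, z)] plays the role of the parameter in
   the covering form of compactness. *)
have /compact_near_coveringP/(_ _ (nbhs (y, z))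
  (fun q x => ~ (E (x, q.2) /\ F x = q.1)) _)[] := cpF _ cK.
  move=> x _; have [Fxy|/eqP Fxy] := pselect (F x = y).
    have nExz : ~ E (x, z).
      by move=> Exz; apply: nFE; exists (x, z); rewrite ?Fxy.
    have [[U V] /= [Ux Vz] UVE] : nbhs (x, z) (~` E).
      by apply: open_nbhs_nbhs; split => //; exact: closed_openC.
    exists (U, [set q | V q.2]) => /=.
      split => //; exists (setT, V) => [|[? ?] []//].
      by split => //; exact: filterT.
    by move=> [x' [y' z']] [/= Ux' Vz'] [Ex'z' _]; exact: (UVE (x', z')).
  move: hY; rewrite open_hausdorff => /(_ _ _ Fxy)[[A B] /=].
  rewrite !inE => -[Ax By] [oA oB AB0].
  exists (F @^-1` A, [set q | B q.1]) => /=.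
    split; first by apply: cF; exact: open_nbhs_nbhs.
    exists (B, setT) => [|[? ?] []//]; split; last exact: filterT.
    exact: open_nbhs_nbhs.
  move=> [x' [y' z']] [/= Ax' By'] [_ Fx'y'].
  suff : (A `&` B) y' by rewrite AB0.
  by split=> //; rewrite -Fx'y'.
move=> [V W] /= [Vy Wz] VW.
have [|_ [[[x' z'] Ex'z' <-] /= [[Kx' Vx'] Wz']]] := clyz ((K `&` V) `*` W).
  by exists (K `&` V, W) => //; split => //; exact: filterI.
by have /(_ x') := VW (F x', z') (conj Vx' Wz'); apply.
Qed.

(** * Continuity of complex-valued functions *)

Lemma normc_re_le (R : realType) (z : R[i]) : `|complex.Re z| <= normc z.
Proof.
case: z => a b /=; rewrite -(sqrtr_sqr a) ler_wsqrtr//.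
by rewrite lerDl sqr_ge0.
Qed.

Lemma normc_im_le (R : realType) (z : R[i]) : `|complex.Im z| <= normc z.
Proof.
case: z => a b /=; rewrite -(sqrtr_sqr b) ler_wsqrtr//.
by rewrite lerDr sqr_ge0.
Qed.

Lemma normc_le_re_im (R : realType) (z : R[i]) :
  normc z <= `|complex.Re z| + `|complex.Im z|.
Proof.
case: z => a b /=; rewrite -[leRHS]ger0_norm ?addr_ge0//.
rewrite -sqrtr_sqr ler_wsqrtr// sqrrD !real_normK ?num_real//.
by rewrite lerD2r lerDl mulrn_wge0// mulr_ge0.
Qed.

(** The filters of [R[i]] are defined with radii in [R[i]]; positive ones are
    real, so real radii suffice. *)
Lemma cvg_normcP (R : realType) (T : Type) (G : set_system T) (FG : Filter G)
    (f : T -> R[i]) (l : R[i]) :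
  f @ G --> l <-> forall e : R, 0 < e -> \forall t \near G, normc (l - f t) < e.
Proof.
split=> [/cvgrPdist_lt fl e e0|fl].
  have /fl : 0 < e%:C by rewrite ltcR.
  by apply: filterS => t; rewrite -[`|_|]/((normc _)%:C) ltcR.
apply/cvgrPdist_lt => e e0.
have er : e = (complex.Re e)%:C by rewrite RRe_real ?gtr0_real.
have /fl : 0 < complex.Re e by rewrite -ltcR -er.
by apply: filterS => t; rewrite -[`|_|]/((normc _)%:C) er ltcR.
Qed.

Section complex_continuity.
Variables (R : realType) (T : topologicalType).

Lemma continuous_normc (f : T -> R[i]) :
  continuous f -> continuous (fun t => normc (f t)).
Proof.
move=> cf t; apply/cvgrPdist_lt => e e0.
have /cvg_normcP/(_ _ e0) := cf t.
apply: (@filterS _ (nbhs t)) => s; apply: le_lt_trans.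
exact: (@ler_dist_dist _ (Rcomplex R)).
Qed.

Lemma continuous_re (f : T -> R[i]) :
  continuous f -> continuous (fun t => complex.Re (f t)).
Proof.
move=> cf t; apply/cvgrPdist_lt => e e0.
have /cvg_normcP/(_ _ e0) := cf t.
apply: (@filterS _ (nbhs t)) => s; apply: le_lt_trans.
by rewrite -raddfB normc_re_le.
Qed.

Lemma continuous_im (f : T -> R[i]) :
  continuous f -> continuous (fun t => complex.Im (f t)).
Proof.
move=> cf t; apply/cvgrPdist_lt => e e0.
have /cvg_normcP/(_ _ e0) := cf t.
apply: (@filterS _ (nbhs t)) => s; apply: le_lt_trans.
by rewrite -raddfB normc_im_le.
Qed.

Lemma continuous_complex (u v : T -> R) : continuous u -> continuous v ->
  continuous (fun t => u t +i* v t).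
Proof.
move=> cu cv t; apply/cvg_normcP => e e0.
have e20 : 0 < e / 2 by rewrite divr_gt0.
have /cvgrPdist_lt/(_ _ e20) hu := cu t.
have /cvgrPdist_lt/(_ _ e20) hv := cv t.
apply: (@filterS2 _ (nbhs t) _ _ _ _ _ hu hv) => s us vs.
by rewrite (le_lt_trans (normc_le_re_im _))// [ltRHS]splitr ltrD.
Qed.

End complex_continuity.

(** * Functions vanishing at infinity *)

Section vanishing_at_infinity.
Variables (R : realType) (X : topologicalType).

Lemma C0_superlevel_compact (f : Cb R X) (e : R) :
  C0 R X f -> 0 < e -> compact [set x | e <= normc (f x)].
Proof.
move=> f0 e0; have [K cK Kf] := f0 _ e0; apply: (subclosed_compact _ cK).
  have /cont_boundedP[/continuous_normc cf _] := Cb_funP f.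
  apply: (@preimage_closed _ _ (fun x => normc (f x)) [set r | e <= r]).
    by move=> x _; exact: cf.
  exact: closed_ge.
by move=> x /= ex; apply: contrapT => /Kf; rewrite ltNge ex.
Qed.

Lemma C0_closed (f : Cb R X) : closure (C0 R X) f -> C0 R X f.
Proof.
move=> /Cb_closureP clf e e0; have e20 : 0 < e / 2 by rewrite divr_gt0.
have [g /(_ _ e20)[K cK Kg] fg] := clf _ e20; exists K => // x nKx.
rewrite -[f x](subrK (g x)) (le_lt_trans (le_normcD _ _))// [ltRHS]splitr.
by rewrite ltrD ?Kg// (le_lt_trans (supnorm_ub (f - g) x)).
Qed.

(** Tietze's and Urysohn's theorems produce real functions on the one-point
    compactification; this turns two of them, vanishing at infinity, into an
    element of [C0 X]. *)
Lemma C0_of_compactification (u v : one_point_compactification X -> R) :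
  continuous u -> continuous v -> u None = 0 -> v None = 0 ->
  exists2 f : Cb R X, C0 R X f &
    forall x, f x = u (Some x) +i* v (Some x).
Proof.
move=> cu cv u0 v0.
pose f x := u (Some x) +i* v (Some x).
have cS (w : one_point_compactification X -> R) :
    continuous w -> continuous (fun x : X => w (Some x)).
  by move=> cw x; exact: (cw (Some x)).
have cf : continuous f by apply: continuous_complex; exact: cS.
have vf (e : R) : 0 < e ->
    exists2 K : set X, compact K & forall x, ~ K x -> normc (f x) < e.
  have cuv : continuous (fun z => u z +i* v z) by exact: continuous_complex.
  have /cvg_normcP := cuv None; rewrite u0 v0.
  move=> /[apply] -[K [cK _] KS]; exists K => // x nKx.
  rewrite -normcN -sub0r; apply: (KS (Some x)).
  by left; exists x.
by exists (MkCb (vanishing_cont_bounded cf vf)).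
Qed.

End vanishing_at_infinity.

(** * Separation by functions vanishing at infinity *)

Section one_point_compactification.
Variables (R : realType) (Y : topologicalType).
Hypotheses (hY : hausdorff_space Y) (lY : locally_compact [set: Y]).
Local Notation opY := (one_point_compactification Y).

Lemma one_point_compactification_normal : normal_space opY.
Proof.
apply: compact_normal; first exact: one_point_compactification_hausdorff.
exact: one_point_compactification_compact.
Qed.

Lemma compact_closed_some (K : set Y) :
  compact K -> closed (Some @` K : set opY).
Proof.
move=> cK; apply: compact_closed.
  exact: one_point_compactification_hausdorff.
apply: continuous_compact => //; apply: continuous_subspaceT.
exact: one_point_compactification_some_continuous.
Qed.

Lemma closed_some_none (B : set Y) :
  closed B -> closed ((Some @` B : set opY) `|` [set None]).
Proof.
move=> cB; rewrite -openC.
have -> : ~` ((Some @` B : set opY) `|` [set None]) = Some @` ~` B.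
  apply/seteqP; split=> [[y|] /not_orP[/= nBy nN]|_ [y nBy <-]].
  - by exists y => // By; apply: nBy; exists y.
  - by case: nN.
  - by case=> // -[y' By' [yy']]; apply: nBy; rewrite -yy'.
by apply: one_point_compactification_open_some; rewrite openC.
Qed.

(** The point at infinity is added to [C], so that the Urysohn function of the
    compactification is [0] there. *)
Lemma C0_urysohn (K C : set Y) : compact K -> closed C -> K `&` C = set0 ->
  exists f : Cb R Y,
    [/\ C0 R Y f, forall y, K y -> f y = 1 & forall y, C y -> f y = 0].
Proof.
move=> cK cC KC0.
have disj : ((Some @` C : set opY) `|` [set None]) `&` Some @` K = set0.
  apply/seteqP; split=> // z [[[y Cy <-]|->] [y' Ky' // [yy']]].
  suff : (K `&` C) y by rewrite KC0.
  by split=> //; rewrite -yy'.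
have [u [cu u0 u1 _]] := urysohn_ext_itv one_point_compactification_normal
  (closed_some_none cC) (compact_closed_some cK) disj (@ltr01 R).
have uN : u None = 0 by apply: u0; exists None => //; right.
have [|//|f f0 fE] := @C0_of_compactification R Y u (cst 0) cu _ uN.
  exact: cst_continuous.
exists f; split=> // y hy; rewrite fE.
  by rewrite (_ : u (Some y) = 1)//; apply: u1; exists (Some y) => //; exists y.
rewrite (_ : u (Some y) = 0)//; apply: u0; exists (Some y) => //.
by left; exists y.
Qed.

End one_point_compactification.

(** * Extension along a proper injection *)

Lemma within_continuous_closed (S T : topologicalType) (D : set S)
    (h : S -> T) :
  (forall C, closed C ->
     exists2 V, closed V & forall z, D z -> (V z <-> C (h z))) ->
  {within D, continuous h}.
Proof.
move=> hC; apply/continuous_closedP => C /hC[V cV VC]; apply/closed_subspaceP.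
by exists V => //; apply/seteqP; split=> z [Hz Dz]; split=> //; apply/(VC _ Dz).
Qed.

Section proper_injection.
Variables (R : realType) (X Y : topologicalType) (F : X -> Y).
Hypotheses (hY : hausdorff_space Y) (lY : locally_compact [set: Y]).
Hypotheses (injF : injective F) (pF : proper_map F).
Local Notation opY := (one_point_compactification Y).

(** On the closed set [D] made of the image of [F] and of the point at infinity,
    let [h] be [u] transported by [F], with value [0] at infinity.  The
    preimage in [D] of a closed [C] is closed.  If [C] contains [0], it is the
    image of [u @^-1` C], closed because [F] is a closed map, together with
    infinity.  Otherwise [C] stays away from [0], so that [u @^-1` C] is
    compact, and so is its image.  Tietze's theorem then applies to [h]. *)
Lemma vanishing_extension (u : X -> R) (M : R) :
  continuous u -> (forall x, `|u x| <= M) ->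
  (forall e, 0 < e -> compact [set x | e <= `|u x|]) ->
  exists v : opY -> R,
    [/\ continuous v, v None = 0 & forall x, v (Some (F x)) = u x].
Proof.
move=> cu uM u0.
pose D : set opY := Some @` range F `|` [set None].
pose h (z : opY) : R :=
  if pselect (exists x, z = Some (F x)) is left ex then u (projT1 (cid ex))
  else 0.
have hF x : h (Some (F x)) = u x.
  rewrite /h; case: pselect => [ex|]; last by case; exists x.
  by case: cid => x' /= [/injF ->].
have hN : h None = 0 by rewrite /h; case: pselect => // -[].
have cD : closed D.
  by apply: closed_some_none; exact: proper_map_closed_image.
have ch : {within D, continuous h}.
  apply: within_continuous_closed => C cC.
  have cuC : closed (u @^-1` C) by apply: preimage_closed => // x _; exact: cu.
  have FuC x : (F @` (u @^-1` C)) (F x) <-> C (u x).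
    by split=> [[x' ux' /injF <-]|ux] //; exists x.
  have SFuC x : (Some @` (F @` (u @^-1` C)) : set opY) (Some (F x)) <-> C (u x).
    by rewrite -FuC; split=> [[y uy [<-]]|ux] //; exists (F x).
  have [C0|nC0] := pselect (C 0).
    exists (Some @` (F @` (u @^-1` C)) `|` [set None]).
      by apply: closed_some_none; exact: proper_map_closed_image.
    move=> z [[_ [x _ <-] <-]|->].
      by rewrite hF -SFuC; split=> [[]|] //; left.
    by rewrite hN; split=> // _; right.
  have [e /= e0 eC] : \forall r \near (0 : R), ~ C r.
    by apply: (@open_nbhs_nbhs _ 0); split; [exact: closed_openC|].
  have cpt : compact (u @^-1` C).
    apply: (subclosed_compact cuC (u0 _ e0)) => x Cux /=.
    rewrite leNgt; apply/negP => uxe; apply: (eC (u x)) => //.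
    by rewrite /ball /= sub0r normrN.
  exists (Some @` (F @` (u @^-1` C))).
    apply: compact_closed_some => //; apply: continuous_compact => //.
    by apply: continuous_subspaceT; exact: pF.1.
  by move=> z [[_ [x _ <-] <-]|->]; rewrite ?hF ?hN //; split=> // -[].
(* Tietze's theorem wants a positive bound, but [M] may be [0] when [u] vanishes
   everywhere, and even negative when [X] is empty. *)
have hM z : D z -> `|h z| <= `|M| + 1.
  have uM1 x : `|u x| <= `|M| + 1.
    by rewrite (le_trans (uM x))// (le_trans (ler_norm M))// lerDl.
  by move=> [[_ [x _ <-] <-]|->]; rewrite ?hF// hN normr0 addr_ge0.
have [|v [hv cv _]] := continuous_bounded_extension
    (one_point_compactification_normal hY lY) cD _ ch hM.
  by rewrite ltr_wpDl.
exists v; split=> // [|x]; first by rewrite -hv ?hN// inE; right.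
by rewrite -hv ?hF// inE; left; exists (F x) => //; exists x.
Qed.

(** The real and the imaginary part of [g] are dominated by its modulus, so each
    satisfies the hypotheses of [vanishing_extension]. *)
Lemma pullback_C0_surjective (cF : continuous F) (g : Cb R X) :
  C0 R X g -> exists2 f : Cb R Y, C0 R Y f & pullback cF f = g.
Proof.
move=> g0; have /cont_boundedP[cg _] := Cb_funP g.
have superlevel (u : X -> R) : continuous u ->
    (forall x, `|u x| <= normc (g x)) ->
    forall e, 0 < e -> compact [set x | e <= `|u x|].
  move=> cu ug e e0; apply: (subclosed_compact _ (C0_superlevel_compact g0 e0)).
    apply: (@preimage_closed _ _ (fun x => `|u x|) [set r | e <= r]).
      by move=> x _; apply: continuous_comp; [exact: cu|exact: norm_continuous].
    exact: closed_ge.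
  by move=> x /= /le_trans; apply.
have bnd (u : X -> R) : (forall x, `|u x| <= normc (g x)) ->
    forall x, `|u x| <= supnorm g.
  by move=> ug x; rewrite (le_trans (ug x))// supnorm_ub.
have re_le x := normc_re_le (g x).
have im_le x := normc_im_le (g x).
have cre := continuous_re cg.
have cim := continuous_im cg.
have [u [cu uN uF]] :=
  vanishing_extension cre (bnd _ re_le) (superlevel _ cre re_le).
have [v [cv vN vF]] :=
  vanishing_extension cim (bnd _ im_le) (superlevel _ cim im_le).
have [f f0 fE] := C0_of_compactification cu cv uN vN.
exists f => //; apply/val_inj/funext => x /=.
by rewrite fE uF vF; case: (g x).
Qed.

End proper_injection.

(** * Density of the image of the pullback *)

Section pullback_density.
Variables (R : realType) (X Y : topologicalType) (F : X -> Y).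
Hypothesis cF : continuous F.

Lemma supnorm_pullback_le (f g : Cb R Y) :
  supnorm (pullback cF f - pullback cF g) <= supnorm (f - g).
Proof.
by apply: supnorm_le => [|x]; [exact: supnorm_ge0|exact: (supnorm_ub (f - g))].
Qed.

Lemma pullback_C0 (f : Cb R Y) :
  (forall K, compact K -> compact (F @^-1` K)) ->
  C0 R Y f -> C0 R X (pullback cF f).
Proof.
move=> cpF f0 e /f0[K /cpF cFK Kf]; exists (F @^-1` K) => // x nKx.
exact: Kf.
Qed.

Lemma closure_pullback_dense (A B : set (Cb R Y)) : norm_dense_in B A ->
  closure (pullback cF @` A) = closure (pullback cF @` B).
Proof.
move=> [AB clA]; apply/seteqP; split; first exact/closureS/image_subset.
move=> f /Cb_closureP clf; apply/Cb_closureP => e e0.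
have e20 : 0 < e / 2 by rewrite divr_gt0.
have [_ [b Bb <-] fb] := clf _ e20.
have /Cb_closureP/(_ _ e20)[a Aa ba] := clA _ Bb.
exists (pullback cF a); first by exists a.
rewrite [ltRHS]splitr -[f](subrK (pullback cF b)) -addrA.
apply: (@le_lt_trans _ _ (supnorm (f - pullback cF b) +
    supnorm (pullback cF b - pullback cF a))).
  by have := ler_Cb_normD (f - pullback cF b) (pullback cF b - pullback cF a);
    rewrite /Cb_norm -rmorphD lecR.
by rewrite ltrD// (le_lt_trans (supnorm_pullback_le _ _)).
Qed.

(** If [F x1 = F x2] with [x1 <> x2], a function [g] of [C0 X] equal to [1] at
    [x1] and to [0] at [x2] is at distance at least [1/2] from every
    [f \o F]. *)
Lemma pullback_dense_injective :
  hausdorff_space X -> locally_compact [set: X] ->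
  C0 R X `<=` closure (range (pullback cF)) -> injective F.
Proof.
move=> hX lX dF x1 x2 Fx; apply: contrapT => x12.
have [] := @C0_urysohn R X hX lX [set x1] [set x2].
- exact: compact_set1.
- by apply: compact_closed => //; exact: compact_set1.
- by apply/seteqP; split=> // x [-> /x12].
move=> g [g0 /(_ x1 erefl) g1 /(_ x2 erefl) g2].
have half0 : 0 < 2^-1 :> R by rewrite invr_gt0.
have /Cb_closureP/(_ _ half0)[_ [f _ <-] gf] := dF _ g0.
have close x : normc (g x - f (F x)) < 2^-1.
  exact: le_lt_trans (supnorm_ub (g - pullback cF f) x) gf.
have := ltrD (close x1) (close x2); rewrite g1 g2 -Fx sub0r normcN.
rewrite -div1r -splitr => /(le_lt_trans (le_normcD _ _)).
by rewrite subrK normc1 ltxx.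
Qed.

(** If [f] in [C0 Y] is [1] on [K], the preimage of [K] is a closed subset of
    the compact set on which the modulus of [f \o F] is at least [1]. *)
Lemma pullback_C0_compact_preimage (K : set Y) :
  hausdorff_space Y -> locally_compact [set: Y] ->
  (forall f : Cb R Y, C0 R Y f -> C0 R X (pullback cF f)) ->
  compact K -> compact (F @^-1` K).
Proof.
move=> hY lY pC0 cK.
have [f [f0 fK _]] := @C0_urysohn R Y hY lY K set0 cK (@closed0 _) (setI0 _).
apply: subclosed_compact (C0_superlevel_compact (pC0 _ f0) ltr01) _.
  by apply: preimage_closed => [x _|]; [exact: cF|exact: compact_closed].
by move=> x FKx /=; rewrite fK// normc1.
Qed.

End pullback_density.

Theorem corollary1p13 (R : realType) (X Y : topologicalType)
    (hX : hausdorff_space X) (lX : locally_compact [set: X])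
    (hY : hausdorff_space Y) (lY : locally_compact [set: Y])
    (F : X -> Y) (cF : continuous F) :
  [<-> injective F /\ proper_map F;
       exists A : set (Cb R Y),
         norm_dense_in (C0 R Y) A /\ closure (pullback cF @` A) = C0 R X;
       forall A : set (Cb R Y),
         norm_dense_in (C0 R Y) A -> closure (pullback cF @` A) = C0 R X].
Proof.
have denseT : norm_dense_in (C0 R Y) (C0 R Y).
  by split=> //; exact: subset_closure.
tfae.
- move=> [injF pF]; exists (C0 R Y); split=> //.
  have cpF := fun K => @proper_map_compact_preimage _ _ F K hX lX hY pF.
  suff -> : pullback cF @` C0 R Y = C0 R X.
    by apply/seteqP; split; [move=> f; exact: C0_closed|exact: subset_closure].
  apply/seteqP; split=> [_ [f f0 <-]|g g0]; first exact: pullback_C0.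
  have [f f0 <-] := pullback_C0_surjective hY lY injF pF cF g0.
  by exists f.
- move=> [A [dA <-]] B dB.
  by rewrite !(closure_pullback_dense cF (B := C0 R Y)).
- move=> /(_ _ denseT) clF; split.
    apply: (@pullback_dense_injective R _ _ _ cF) => //; rewrite -clF.
    by apply: closureS => _ [f _ <-]; exists f.
  have pC0 f : C0 R Y f -> C0 R X (pullback cF f).
    by move=> f0; rewrite -clF; apply: subset_closure; exists f.
  apply: compact_preimage_proper_map => // K.
  exact: pullback_C0_compact_preimage pC0.
Qed.
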